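(* Let $\mathcal{A}$ be a finite-dimensional vector space, let $(\mathcal{A},[\cdot,\cdot],N)$ be a Nijenhuis mock-Lie algebra, and let $\Delta:\mathcal{A}\to\mathcal{A}\otimes\mathcal{A}$ and $S:\mathcal{A}\to\mathcal{A}$ be linear maps such that $(\mathcal{A}^*,[\cdot,\cdot]_{\mathcal{A}^*},S^* )$ is a Nijenhuis mock-Lie algebra, where $[\cdot,\cdot]_{\mathcal{A}^*}=\Delta^*$. Then the following conditions are equivalent: (1) $((\mathcal{A},N),(\mathcal{A}^*,S^* ),ad^*,Ad^* )$ is a matched pair of Nijenhuis mock-Lie algebras. (2) There is a Manin triple $((\mathcal{A}\oplus\mathcal{A}^*,[\cdot,\cdot]_\diamond,N+S^* ),(\mathcal{A},N),(\mathcal{A}^*,S^* ),\mathfrak{B}_d)$ of a Nijenhuis mock-Lie algebra associated to $(\mathcal{A},[\cdot,\cdot],N)$ and $(\mathcal{A}^*,[\cdot,\cdot]_{\mathcal{A}^*},S^* )$. (3) $(\mathcal{A},[\cdot,\cdot],\Delta,N,S)$ is a Nijenhuis mock-Lie bialgebra.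
   Context: All vector spaces are over a field $K$ of characteristic zero. A mock-Lie algebra is a vector space with a commutative bilinear map $[\cdot,\cdot]$ such that $[x,[y,z]]+[y,[z,x]]+[z,[x,y]]=0$. A Nijenhuis mock-Lie algebra $(\mathcal{A},[\cdot,\cdot],N)$ is a mock-Lie algebra with a linear map $N$ such that $[N(x),N(y)]+N^2([x,y])=N([N(x),y])+N([x,N(y)])$. The bracket $\Delta^*$ on $\mathcal{A}^*$ is $\langle[a^*,b^*]_{\mathcal{A}^*},x\rangle=\langle a^*\otimes b^*,\Delta(x)\rangle$; $S^*,N^*$ denote transposes. Representations: $(V,\rho)$ is a representation of a mock-Lie algebra if $\rho([x,y])v=-\rho(x)(\rho(y)v)-\rho(y)(\rho(x)v)$; $(V,\rho,\alpha)$ is a representation of $(\mathcal{A},[\cdot,\cdot],N)$ if moreover $\alpha\in\mathrm{End}(V)$ satisfies $\rho(N(x))\alpha(v)+\alpha^2(\rho(x)v)=\alpha(\rho(N(x))v)+\alpha(\rho(x)\alpha(v))$. The map $ad^*:\mathcal{A}\to\mathrm{End}(\mathcal{A}^* )$ is $\langle ad^*(x)a^*,y\rangle=\langle a^*,[x,y]\rangle$, and $Ad^*:\mathcal{A}^*\to\mathrm{End}(\mathcal{A})$ is $\langle Ad^*(a^* )x,b^*\rangle=\langle x,[a^*,b^*]_{\mathcal{A}^*}\rangle$ (using $\mathcal{A}^{**}=\mathcal{A}$). Matched pairs: for mock-Lie algebras $\mathcal{A},\mathcal{A}'$ and linear $\rho_{\mathcal{A}}:\mathcal{A}\to\mathrm{End}(\mathcal{A}')$,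 $\rho_{\mathcal{A}'}:\mathcal{A}'\to\mathrm{End}(\mathcal{A})$, $(\mathcal{A},\mathcal{A}',\rho_{\mathcal{A}},\rho_{\mathcal{A}'})$ is a matched pair of mock-Lie algebras if $(\mathcal{A}',\rho_{\mathcal{A}})$ is a representation of $\mathcal{A}$, $(\mathcal{A},\rho_{\mathcal{A}'})$ is a representation of $\mathcal{A}'$, and for all $a,b\in\mathcal{A}$, $x,y\in\mathcal{A}'$ $$\rho_{\mathcal{A}}(a)[x,y]+[\rho_{\mathcal{A}}(a)x,y]+[x,\rho_{\mathcal{A}}(a)y]+\rho_{\mathcal{A}}(\rho_{\mathcal{A}'}(y)a)x+\rho_{\mathcal{A}}(\rho_{\mathcal{A}'}(x)a)y=0,$$ $$\rho_{\mathcal{A}'}(x)[a,b]+[\rho_{\mathcal{A}'}(x)a,b]+[a,\rho_{\mathcal{A}'}(x)b]+\rho_{\mathcal{A}'}(\rho_{\mathcal{A}}(b)x)a+\rho_{\mathcal{A}'}(\rho_{\mathcal{A}}(a)x)b=0.$$ $((\mathcal{A},N_{\mathcal{A}}),(\mathcal{A}',N_{\mathcal{A}'}),\rho_{\mathcal{A}},\rho_{\mathcal{A}'})$ is a matched pair of Nijenhuis mock-Lie algebras if, in addition, $(\mathcal{A}',\rho_{\mathcal{A}},N_{\mathcal{A}'})$ is a representation of $(\mathcal{A},[\cdot,\cdot],N_{\mathcal{A}})$ and $(\mathcal{A},\rho_{\mathcal{A}'},N_{\mathcal{A}})$ is a representation of $(\mathcal{A}',[\cdot,\cdot],N_{\mathcal{A}'})$.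 Manin triples: a Manin triple of a Nijenhuis mock-Lie algebra associated to $(\mathcal{A},[\cdot,\cdot],N)$ and $(\mathcal{A}^*,[\cdot,\cdot]_{\mathcal{A}^*},S^* )$ is a mock-Lie bracket $[\cdot,\cdot]_\diamond$ on $\mathcal{A}\oplus\mathcal{A}^*$ such that $(\mathcal{A},[\cdot,\cdot])$ and $(\mathcal{A}^*,[\cdot,\cdot]_{\mathcal{A}^*})$ are mock-Lie subalgebras, the bilinear form $\mathfrak{B}_d(x+a^*,y+b^* )=\langle a^*,y\rangle+\langle b^*,x\rangle$ is invariant, i.e. $\mathfrak{B}_d([u,v]_\diamond,w)=\mathfrak{B}_d(u,[v,w]_\diamond)$, and $(\mathcal{A}\oplus\mathcal{A}^*,[\cdot,\cdot]_\diamond,N+S^* )$ is a Nijenhuis mock-Lie algebra, where $(N+S^* )(x+a^* )=N(x)+S^*(a^* )$. Bialgebras: a mock-Lie coalgebra $(\mathcal{A},\Delta)$, $\Delta(x)=x_{(1)}\otimes x_{(2)}$, satisfies $x_{(1)}\otimes x_{(2)}=x_{(2)}\otimes x_{(1)}$ and $x_{(1)}\otimes x_{(2)(1)}\otimes x_{(2)(2)}+x_{(1)(1)}\otimes x_{(1)(2)}\otimes x_{(2)}+x_{(2)(1)}\otimes x_{(1)}\otimes x_{(2)(2)}=0$. A mock-Lie bialgebra is a mock-Lie algebra and mock-Lie coalgebra with $\Delta([x,y])=-[x,y_{(1)}]\otimes y_{(2)}-y_{(1)}\otimes[x,y_{(2)}]-[y,x_{(1)}]\otimes x_{(2)}-x_{(1)}\otimes[y,x_{(2)}]$.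 A Nijenhuis mock-Lie coalgebra $(\mathcal{A},\Delta,S)$ is a mock-Lie coalgebra with a linear map $S$ such that $(S\otimes S)\Delta+\Delta S^2=(S\otimes\mathrm{id})\Delta S+(\mathrm{id}\otimes S)\Delta S$. A Nijenhuis mock-Lie bialgebra $(\mathcal{A},[\cdot,\cdot],\Delta,N,S)$ consists of a mock-Lie bialgebra $(\mathcal{A},[\cdot,\cdot],\Delta)$ such that $(\mathcal{A},[\cdot,\cdot],N)$ is a Nijenhuis mock-Lie algebra, $(\mathcal{A},\Delta,S)$ is a Nijenhuis mock-Lie coalgebra, $S([N(x),y])+[x,S^2(y)]=[N(x),S(y)]+S([x,S(y)])$ for all $x,y\in\mathcal{A}$, and $(S\otimes\mathrm{id})\Delta N+(\mathrm{id}\otimes N^2)\Delta=(S\otimes N)\Delta+(\mathrm{id}\otimes N)\Delta N$. *)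

(* Defs.v *)
From HB Require Import structures.
From mathcomp Require Import all_boot all_order all_algebra.

Set Implicit Arguments.
Unset Strict Implicit.
Unset Printing Implicit Defensive.

Import GRing.Theory.
Local Open Scope ring_scope.

Notation dual V := 'Hom(V, GRing.regular _).

Section LinearAlgebra.
Variable K : fieldType.
Implicit Types U V W X : vectType K.

(* [linfun f] is specified only for linear f; the lemmas named *E and *_pure  *)
(* discharge this for each use of it below.                                   *)
Lemma linfunE U V (f : U -> V) u : linear f -> linfun f u = f u.
Proof.
move=> lin.
pose F : {linear U -> V} := HB.pack f (GRing.isLinear.Build _ _ _ _ f lin).
exact: (lfunE F).
Qed.

Definition bilin U V W (beta : U -> V -> W) :=
  (forall u, linear (beta u)) /\ (forall v, linear (beta^~ v)).

Definition transpose U V (f : 'Hom(U, V)) : 'Hom(dual V, dual U) :=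
  linfun (fun a : dual V => (a \o f)%VF).

Lemma transposeE U V (f : 'Hom(U, V)) (a : dual V) u :
  transpose f a u = a (f u).
Proof.
rewrite linfunE ?comp_lfunE // => k b c.
by rewrite comp_lfunDl comp_lfunZl.
Qed.

(* The canonical map from V to its bidual. *)
Definition evdual V : 'Hom(V, dual (dual V)) :=
  linfun (fun v => linfun (fun a : dual V => a v)).

Lemma evdualE V v (a : dual V) : evdual V v a = a v.
Proof.
have lin1 w : linear (fun a : dual V => a w).
  by move=> k b c; rewrite add_lfunE scale_lfunE.
rewrite linfunE ?linfunE // => k x y; apply/lfunP=> b.
by rewrite add_lfunE scale_lfunE !linfunE // linearP.
Qed.

Definition dcoord U (i : 'I_(\dim {:U})) : dual U :=
  linfun (coord (vbasis {:U}) i : U -> GRing.regular K).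

Lemma dcoordE U i (u : U) : dcoord i u = coord (vbasis {:U}) i u.
Proof. exact: lfunE. Qed.

Lemma dual_sum U (a : dual U) :
  a = \sum_(i < \dim {:U}) a (vbasis {:U})`_i *: dcoord i.
Proof.
apply/lfunP => u; rewrite sum_lfunE.
rewrite [in LHS](coord_vbasis (memvf u)) linear_sum; apply: eq_bigr => i _.
by rewrite scale_lfunE linearZ dcoordE /=; apply: mulrC.
Qed.

Lemma evdual_bij V : bijective (evdual V).
Proof.
pose g (phi : dual (dual V)) : V :=
  \sum_(i < \dim {:V}) phi (dcoord i) *: (vbasis {:V})`_i.
exists g => [v|phi].
  rewrite /g [RHS](coord_vbasis (memvf v)); apply: eq_bigr => i _.
  by rewrite evdualE dcoordE.
apply/lfunP=> a; rewrite evdualE linear_sum [in RHS](dual_sum a) linear_sum.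
by apply: eq_bigr => i _; rewrite !linearZ; apply: mulrC.
Qed.

(* In finite dimension U (x) V is Hom(U^*, V), the pure tensor u (x) v being  *)
(* a |-> a(u) v. Lemmas [tlift_pure] and [tensor_ext] below are the universal *)
(* property of the tensor product.                                            *)
Definition tensor U V : vectType K := 'Hom(dual U, V).

Definition thom U V (t : tensor U V) : 'Hom(dual U, V) := t.

Lemma thomP U V (t t' : tensor U V) :
  (forall a, thom t a = thom t' a) -> t = t'.
Proof. by move=> tt'; apply/(lfunP (thom t)). Qed.

Lemma thom_linear U V k (t t' : tensor U V) a :
  thom (k *: t + t') a = k *: thom t a + thom t' a.
Proof. by rewrite /thom add_lfunE scale_lfunE. Qed.

Definition pure U V (u : U) (v : V) : tensor U V :=
  linfun (fun a : dual U => a u *: v).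

Lemma pureE U V (u : U) (v : V) (a : dual U) : thom (pure u v) a = a u *: v.
Proof.
rewrite /thom linfunE // => k b c.
by rewrite add_lfunE scale_lfunE scalerDl scalerA.
Qed.

(* The linear map u (x) v |-> beta u v induced by a bilinear beta; applied to *)
(* a tensor t = t_(1) (x) t_(2) it is the Sweedler expression                 *)
(* beta t_(1) t_(2). It does not depend on the basis used to define it.       *)
Definition tlift U V W (beta : U -> V -> W) : 'Hom(tensor U V, W) :=
  linfun (fun t : tensor U V =>
    \sum_(i < \dim {:U}) beta (vbasis {:U})`_i (thom t (dcoord i))).

Lemma tliftE U V W (beta : U -> V -> W) (t : tensor U V) : bilin beta ->
  tlift beta t = \sum_(i < \dim {:U}) beta (vbasis {:U})`_i (thom t (dcoord i)).
Proof.
move=> [linr _]; rewrite linfunE // => k s s'.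
rewrite scaler_sumr -big_split /=; apply: eq_bigr => i _.
by rewrite thom_linear linr.
Qed.

Lemma tlift_pure U V W (beta : U -> V -> W) u v : bilin beta ->
  tlift beta (pure u v) = beta u v.
Proof.
move=> bb; rewrite tliftE //; have [linr linl] := bb.
rewrite [in RHS](coord_vbasis (memvf u)).
rewrite -[RHS](linfunE (f := beta^~ v) _ (linl v)) linear_sum.
apply: eq_bigr => i _; rewrite pureE dcoordE linearZ /= linfunE //.
by rewrite -[LHS](linfunE _ (linr _)) linearZ /= linfunE.
Qed.

Lemma tensor_sum U V (t : tensor U V) :
  t = \sum_(i < \dim {:U}) pure (vbasis {:U})`_i (thom t (dcoord i)).
Proof.
apply/(lfunP (thom t)) => a; rewrite /thom sum_lfunE {1}(dual_sum a) linear_sum.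
by apply: eq_bigr => i _; rewrite -[in RHS]/(thom (pure _ _)) pureE linearZ.
Qed.

Lemma tensor_ext U V W (f g : 'Hom(tensor U V, W)) :
  (forall u v, f (pure u v) = g (pure u v)) -> f = g.
Proof.
move=> fg; apply/lfunP => t; rewrite (tensor_sum t) !linear_sum.
by apply: eq_bigr => i _; apply: fg.
Qed.

Lemma pure_bilin U V : bilin (@pure U V).
Proof.
split=> [u|v] k x y; apply: thomP => a; rewrite thom_linear !pureE.
  by rewrite scalerDr !scalerA mulrC.
by rewrite linearP scalerDl -scalerA.
Qed.

Local Opaque tensor thom pure tlift.

Definition tmap U V W X (f : 'Hom(U, W)) (g : 'Hom(V, X)) :
    'Hom(tensor U V, tensor W X) :=
  tlift (fun u v => pure (f u) (g v)).

Lemma tmap_pure U V W X (f : 'Hom(U, W)) (g : 'Hom(V, X)) u v :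
  tmap f g (pure u v) = pure (f u) (g v).
Proof.
rewrite /tmap tlift_pure //; have [bl br] := pure_bilin W X.
by split=> [x|x] k y z; rewrite linearP (bl, br).
Qed.

Definition tflip U V : 'Hom(tensor U V, tensor V U) :=
  tlift (fun u v => pure v u).

Lemma tflip_pure U V (u : U) (v : V) : tflip U V (pure u v) = pure v u.
Proof.
rewrite /tflip tlift_pure //; have [bl br] := pure_bilin V U.
by split=> x; [apply: br | apply: bl].
Qed.

Definition tassoc U V W :
    'Hom(tensor (tensor U V) W, tensor U (tensor V W)) :=
  tlift (fun (t : tensor U V) w => tlift (fun u v => pure u (pure v w)) t).

Lemma tassoc_pure U V W (u : U) (v : V) (w : W) :
  tassoc U V W (pure (pure u v) w) = pure u (pure v w).
Proof.
have [bl br] := pure_bilin U (tensor V W).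
have [bl' br'] := pure_bilin V W.
have b1 x : bilin (fun (y : U) (z : V) => pure y (pure z (x : W))).
  by split=> [y|y] k z z'; [rewrite br' bl | rewrite br].
rewrite /tassoc tlift_pure; first exact: (tlift_pure _ _ (b1 _)).
split=> [t|x] k y z; last exact: linearP.
rewrite !(tliftE _ (b1 _)) scaler_sumr -big_split; apply: eq_bigr => i _ /=.
by rewrite bl' bl.
Qed.

(* The map t |-> <a (x) b, t>. *)
Definition tpair U V (a : dual U) (b : dual V) : dual (tensor U V) :=
  tlift (fun u v => a u * b v : GRing.regular K).

Lemma tpair_bilin U V (a : dual U) (b : dual V) :
  bilin (fun u v => a u * b v : GRing.regular K).
Proof.
split=> [x|x] k y z; rewrite linearP.
  by rewrite mulrDr; congr (_ + _); apply: mulrCA.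
by rewrite mulrDl; congr (_ + _); symmetry; apply: mulrA.
Qed.

Lemma tpair_pure U V (a : dual U) (b : dual V) u v :
  tpair a b (pure u v) = a u * b v.
Proof. by rewrite /tpair tlift_pure //; apply: tpair_bilin. Qed.

End LinearAlgebra.

(* Unfolding these makes canonical structure inference on iterated tensor     *)
(* products intractable: use the lemmas above instead.                        *)
#[global] Opaque tensor thom pure tlift.

Section MockLie.
Variable K : fieldType.
Implicit Types A V : vectType K.

(* A bilinear bracket [x, y] on A is given as the linear map x |-> [x, -].    *)
Record is_mockLie A (br : 'Hom(A, 'End(A))) : Prop := IsMockLie {
  mockLieC : forall x y, br x y = br y x;
  mockLieJ : forall x y z,
    br x (br y z) + br y (br z x) + br z (br x y) = 0
}.

Record is_NijenhuisMockLie A (br : 'Hom(A, 'End(A))) (N : 'End(A)) : Prop :=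
  IsNijenhuisMockLie {
  NML_mockLie : is_mockLie br;
  NML_Nijenhuis : forall x y,
    br (N x) (N y) + N (N (br x y)) = N (br (N x) y) + N (br x (N y))
}.

Definition is_rep A V (br : 'Hom(A, 'End(A))) (rho : 'Hom(A, 'End(V))) : Prop :=
  forall x y v, rho (br x y) v = - rho x (rho y v) - rho y (rho x v).

Record is_NijenhuisRep A V (br : 'Hom(A, 'End(A))) (N : 'End(A))
    (rho : 'Hom(A, 'End(V))) (alpha : 'End(V)) : Prop := IsNijenhuisRep {
  NR_rep : is_rep br rho;
  NR_Nijenhuis : forall x v,
    rho (N x) (alpha v) + alpha (alpha (rho x v))
    = alpha (rho (N x) v) + alpha (rho x (alpha v))
}.

Record is_matchedPair A A' (br : 'Hom(A, 'End(A))) (br' : 'Hom(A', 'End(A')))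
    (rho : 'Hom(A, 'End(A'))) (rho' : 'Hom(A', 'End(A))) : Prop :=
  IsMatchedPair {
  MP_mockLie : is_mockLie br;
  MP_mockLie' : is_mockLie br';
  MP_rep : is_rep br rho;
  MP_rep' : is_rep br' rho';
  MP_compat : forall a x y,
    rho a (br' x y) + br' (rho a x) y + br' x (rho a y)
    + rho (rho' y a) x + rho (rho' x a) y = 0;
  MP_compat' : forall x a b,
    rho' x (br a b) + br (rho' x a) b + br a (rho' x b)
    + rho' (rho b x) a + rho' (rho a x) b = 0
}.

Record is_NijenhuisMatchedPair A A'
    (br : 'Hom(A, 'End(A))) (N : 'End(A))
    (br' : 'Hom(A', 'End(A'))) (N' : 'End(A'))
    (rho : 'Hom(A, 'End(A'))) (rho' : 'Hom(A', 'End(A))) : Prop :=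
  IsNijenhuisMatchedPair {
  NMP_NML : is_NijenhuisMockLie br N;
  NMP_NML' : is_NijenhuisMockLie br' N';
  NMP_matchedPair : is_matchedPair br br' rho rho';
  NMP_rep : is_NijenhuisRep br N rho N';
  NMP_rep' : is_NijenhuisRep br' N' rho' N
}.

(* ad^* : A -> End(A^* ) *)
Definition coad A (br : 'Hom(A, 'End(A))) : 'Hom(A, 'End(dual A)) :=
  linfun (fun x => transpose (br x)).

Lemma coadE A (br : 'Hom(A, 'End(A))) x (a : dual A) y :
  coad br x a y = a (br x y).
Proof.
rewrite linfunE ?transposeE // => k u v; apply/lfunP => b; apply/lfunP => w.
rewrite !(add_lfunE, scale_lfunE) !transposeE linearP.
by rewrite add_lfunE scale_lfunE linearP.
Qed.

(* Ad^* : A^* -> End(A), i.e. the map [coad] of the bracket of A^*, acting on *)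
(* the bidual, transported to A along the bijection [evdual A].               *)
Definition Coad A (brd : 'Hom(dual A, 'End(dual A))) : 'Hom(dual A, 'End(A)) :=
  linfun (fun a => ((evdual A)^-1 \o (coad brd a \o evdual A))%VF).

Lemma CoadE A (brd : 'Hom(dual A, 'End(dual A))) (a b : dual A) x :
  b (Coad brd a x) = brd a b x.
Proof.
rewrite linfunE => [|k u v].
  rewrite !comp_lfunE -evdualE.
  have [g _ evK] := evdual_bij A.
  rewrite limg_lfunVK ?coadE ?evdualE //.
  by rewrite -[X in X \in _]evK memv_img ?memvf.
by rewrite linearP comp_lfunDl comp_lfunDr -comp_lfunZl -comp_lfunZr.
Qed.

(* The bracket Delta^* on A^*. *)
Definition dual_bracket A (Delta : 'Hom(A, tensor A A)) :
    'Hom(dual A, 'End(dual A)) :=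
  linfun (fun a => linfun (fun b => (tpair a b \o Delta)%VF)).

Lemma dual_bracketE A (Delta : 'Hom(A, tensor A A)) (a b : dual A) x :
  dual_bracket Delta a b x = tpair a b (Delta x).
Proof.
have tpl k (a1 a2 c : dual A) :
    tpair (k *: a1 + a2) c = k *: tpair a1 c + tpair a2 c.
  apply: tensor_ext => u v; rewrite add_lfunE scale_lfunE !tpair_pure.
  by rewrite add_lfunE scale_lfunE mulrDl; congr (_ + _); symmetry; apply: mulrA.
have tpr k (a1 a2 c : dual A) :
    tpair c (k *: a1 + a2) = k *: tpair c a1 + tpair c a2.
  apply: tensor_ext => u v; rewrite add_lfunE scale_lfunE !tpair_pure.
  by rewrite add_lfunE scale_lfunE mulrDr; congr (_ + _); apply: mulrCA.
have lin1 c : linear (fun b : dual A => (tpair c b \o Delta)%VF).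
  by move=> k b1 b2; rewrite tpr comp_lfunDl comp_lfunZl.
rewrite linfunE => [|k a1 a2].
  by rewrite linfunE // comp_lfunE.
apply/lfunP => c.
by rewrite add_lfunE scale_lfunE !linfunE // tpl comp_lfunDl comp_lfunZl.
Qed.

(* The canonical symmetric form B_d and the map N + M on A (+) A^*. *)
Definition double_form A (u v : A * dual A) : K := u.2 v.1 + v.2 u.1.

Definition double_map A (N : 'End(A)) (M : 'End(dual A)) :
    'End((A * dual A)%type) :=
  linfun (fun u : A * dual A => (N u.1, M u.2)).

Lemma double_mapE A (N : 'End(A)) (M : 'End(dual A)) x a :
  double_map N M (x, a) = (N x, M a).
Proof. by rewrite linfunE //= => k u v /=; rewrite !linearP. Qed.

Record is_ManinTriple A (br : 'Hom(A, 'End(A))) (N : 'End(A))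
    (brd : 'Hom(dual A, 'End(dual A))) (M : 'End(dual A))
    (brD : 'Hom((A * dual A)%type, 'End((A * dual A)%type))) : Prop :=
  IsManinTriple {
  MT_mockLie : is_mockLie brD;
  MT_sub : forall x y : A, brD (x, 0) (y, 0) = (br x y, 0);
  MT_sub_dual : forall a b : dual A, brD (0, a) (0, b) = (0, brd a b);
  MT_invariant : forall u v w,
    double_form (brD u v) w = double_form u (brD v w);
  MT_Nijenhuis : is_NijenhuisMockLie brD (double_map N M)
}.

(* In [coalg_coJacobi] the three terms are compared in A (x) (A (x) A); the   *)
(* last one is x_(2)(1) (x) x_(1) (x) x_(2)(2), obtained from                 *)
(* x_(1) (x) x_(2)(1) (x) x_(2)(2) by exchanging the first two factors.       *)
Definition swap12 A : 'End(tensor A (tensor A A)) :=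
  tlift (fun x t => tlift (fun y z => pure y (pure x z)) t).

Lemma swap12_pure A (x y z : A) :
  swap12 A (pure x (pure y z)) = pure y (pure x z).
Proof.
have [bl br] := pure_bilin A (tensor A A).
have [bl' br'] := pure_bilin A A.
have b1 (u : A) : bilin (fun v w : A => pure v (pure u w)).
  by split=> [v|v] k w w'; [rewrite (bl' u) (bl v) | apply: br].
rewrite /swap12 tlift_pure; first exact: (tlift_pure _ _ (b1 _)).
split=> [u|t] k v w; first exact: linearP.
rewrite !(tliftE _ (b1 _)) scaler_sumr -big_split; apply: eq_bigr => i _ /=.
by rewrite (br' _ k v w) bl.
Qed.

Record is_mockLieCoalgebra A (Delta : 'Hom(A, tensor A A)) : Prop :=
  IsMockLieCoalgebra {
  coalg_cocomm : forall x, Delta x = tflip A A (Delta x);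
  coalg_coJacobi : forall x,
    tmap \1%VF Delta (Delta x) + tassoc A A A (tmap Delta \1%VF (Delta x))
    + swap12 A (tmap \1%VF Delta (Delta x)) = 0
}.

Record is_mockLieBialgebra A (br : 'Hom(A, 'End(A)))
    (Delta : 'Hom(A, tensor A A)) : Prop := IsMockLieBialgebra {
  bialg_mockLie : is_mockLie br;
  bialg_coalgebra : is_mockLieCoalgebra Delta;
  bialg_compat : forall x y,
    Delta (br x y) =
      - tmap (br x) \1%VF (Delta y) - tmap \1%VF (br x) (Delta y)
      - tmap (br y) \1%VF (Delta x) - tmap \1%VF (br y) (Delta x)
}.

Record is_NijenhuisCoalgebra A (Delta : 'Hom(A, tensor A A)) (S : 'End(A)) :
    Prop := IsNijenhuisCoalgebra {
  NC_coalgebra : is_mockLieCoalgebra Delta;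
  NC_Nijenhuis : forall x,
    tmap S S (Delta x) + Delta (S (S x))
    = tmap S \1%VF (Delta (S x)) + tmap \1%VF S (Delta (S x))
}.

Record is_NijenhuisBialgebra A (br : 'Hom(A, 'End(A)))
    (Delta : 'Hom(A, tensor A A)) (N S : 'End(A)) : Prop :=
  IsNijenhuisBialgebra {
  NB_bialgebra : is_mockLieBialgebra br Delta;
  NB_NML : is_NijenhuisMockLie br N;
  NB_coalgebra : is_NijenhuisCoalgebra Delta S;
  NB_compat : forall x y,
    S (br (N x) y) + br x (S (S y)) = br (N x) (S y) + S (br x (S y));
  NB_cocompat : forall x,
    tmap S \1%VF (Delta (N x)) + tmap \1%VF (N \o N)%VF (Delta x)
    = tmap S N (Delta x) + tmap \1%VF N (Delta (N x))
}.

End MockLie.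

(* Main.v *)
Require Import Defs.
From HB Require Import structures.
From mathcomp Require Import all_boot all_order all_algebra.
From mathcomp Require Import ring.
Import GRing.Theory.
Local Open Scope ring_scope.

(** All three conditions say the same two things: a quadrilinear identity
    [pairing_compat] in two elements x, y of A and two elements a, b of its dual,
<<
      <[a,b],[x,y]> + <x.a, b.y> + <x.b, a.y> + <y.a, b.x> + <y.b, a.x> = 0,
>>
    where the dots are the coadjoint actions, and the Nijenhuis conditions on the
    two coadjoint actions.

    The identity comes from the double. For a commutative bracket with a
    nondegenerate invariant form, <t, [u, [v, w]]> = <[t, u], [v, w]>, so the
    Jacobi identity means that the sum of <[t, u], [v, w]> over the three ways of
    splitting {t, u, v, w} into pairs vanishes ([invariant_jacobi]). This sum is
    symmetric in the four arguments. On the sum of A and its dual, it vanishes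
    automatically unless exactly two arguments lie in A, because A and its dual
    are isotropic and satisfy the Jacobi identity; the remaining case is
    [pairing_compat] ([bicross_jacobi]). Invariance also forces the bracket of the
    double to be the one built from the coadjoint actions ([bicross_unique]), and
    the Nijenhuis identity of N + S^* on it splits into those of A and of its
    dual and those of the two actions ([bicross_nijenhuis]). This settles Manin
    triples.

    Each compatibility condition of a matched pair is the quadrilinear identity
    with one argument removed by nondegeneracy ([ad_compat]); the symmetry of the
    identity under exchange of A and its dual makes the two conditions
    equivalent. Finally, an identity between tensors holds as soon as it holds
    after pairing with all decomposable functionals, and pairing with a (x) b
    turns the bialgebra cocycle condition into [pairing_compat], the coalgebra
    axioms into the axioms of the dual bracket, and the conditions on S and on N
    into the Nijenhuis conditions on the two coadjoint actions. *)

Set Implicit Arguments.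
Unset Strict Implicit.
Unset Printing Implicit Defensive.

(** * Separating tensors by pairings *)

Section Pairing.
Variable K : fieldType.
Implicit Types U V W X : vectType K.

(** The bidual map is injective, so vectors of a finite-dimensional space are
    separated by functionals. *)
Lemma dual_sep V (v w : V) : (forall a : dual V, a v = a w) -> v = w.
Proof.
move=> eq_vw; have [g evK _] := evdual_bij V; rewrite -[v]evK -[w]evK.
by congr g; apply/lfunP => a; rewrite !evdualE.
Qed.

Lemma transpose1 V (a : dual V) : transpose \1%VF a = a.
Proof. by apply/lfunP => v; rewrite transposeE id_lfunE. Qed.

(** Identifies the pairing with evaluation of the homomorphism that encodes a
    tensor; this reduces nondegeneracy of tensor pairings to [dual_sep]. *)
Lemma tpairE U V (a : dual U) (b : dual V) t : tpair a b t = b (thom t a).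
Proof.
rewrite (tensor_sum t) linear_sum.
have -> : thom (\sum_(i < \dim {:U}) pure (vbasis {:U})`_i (thom t (dcoord i))) a
  = \sum_(i < \dim {:U}) a (vbasis {:U})`_i *: thom t (dcoord i).
  rewrite -tensor_sum {1}(dual_sum a).
  by rewrite linear_sum; apply: eq_bigr => i _; rewrite linearZ.
rewrite linear_sum; apply: eq_bigr => i _.
by rewrite [RHS]linearZ /= tpair_pure.
Qed.

Lemma tpair_sep U V (t t' : tensor U V) :
  (forall a b, tpair a b t = tpair a b t') -> t = t'.
Proof.
move=> eq_tt'; apply: thomP => a; apply: dual_sep => b.
by rewrite -!tpairE eq_tt'.
Qed.

Lemma tpair_sep3 U V W (t t' : tensor U (tensor V W)) :
    (forall a b c, tpair a (tpair b c) t = tpair a (tpair b c) t') -> t = t'.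
Proof.
move=> eq_tt'; apply: thomP => a; apply: tpair_sep => b c.
by rewrite -!tpairE eq_tt'.
Qed.

Lemma tensor_ext3r U V W X (f g : 'Hom(tensor U (tensor V W), X)) :
  (forall u v w, f (pure u (pure v w)) = g (pure u (pure v w))) -> f = g.
Proof.
move=> eq_fg; apply: tensor_ext => u t.
have [bl _] := pure_bilin U (tensor V W).
have linp (h : 'Hom(tensor U (tensor V W), X)) :
    linear (fun s : tensor V W => h (pure u s)).
  by move=> k s s'; rewrite bl linearP.
rewrite -[LHS](linfunE _ (linp f)) -[RHS](linfunE _ (linp g)).
by congr (fun_of_lfun _ t); apply: tensor_ext => v w; rewrite !linfunE.
Qed.

Lemma tensor_ext3l U V W X (f g : 'Hom(tensor (tensor U V) W, X)) :
  (forall u v w, f (pure (pure u v) w) = g (pure (pure u v) w)) -> f = g.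
Proof.
move=> eq_fg; apply: tensor_ext => t w.
have [_ br] := pure_bilin (tensor U V) W.
have linp (h : 'Hom(tensor (tensor U V) W, X)) :
    linear (fun s : tensor U V => h (pure s w)).
  by move=> k s s'; rewrite br linearP.
rewrite -[LHS](linfunE _ (linp f)) -[RHS](linfunE _ (linp g)).
by congr (fun_of_lfun _ t); apply: tensor_ext => u v; rewrite !linfunE.
Qed.

(** Tensor maps are adjoint to the transposes of their factors. This and the
    three lemmas after it turn the tensor identities of coalgebras into
    identities between brackets of functionals. *)
Lemma tpair_tmap U V W X (f : 'Hom(U, W)) (g : 'Hom(V, X))
    (a : dual W) (b : dual X) t :
  tpair a b (tmap f g t) = tpair (transpose f a) (transpose g b) t.
Proof.
rewrite -[LHS]comp_lfunE; congr (fun_of_lfun _ t); apply: tensor_ext => u v.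
by rewrite comp_lfunE tmap_pure !tpair_pure !transposeE.
Qed.

Lemma tpair_tflip U V (a : dual V) (b : dual U) t :
  tpair a b (tflip U V t) = tpair b a t.
Proof.
rewrite -[LHS]comp_lfunE; congr (fun_of_lfun _ t); apply: tensor_ext => u v.
by rewrite comp_lfunE tflip_pure !tpair_pure mulrC.
Qed.

Lemma tpair_tassoc U V W (a : dual U) (b : dual V) (c : dual W) t :
  tpair a (tpair b c) (tassoc U V W t) = tpair (tpair a b) c t.
Proof.
rewrite -[LHS]comp_lfunE; congr (fun_of_lfun _ t).
apply: tensor_ext3l => u v w.
by rewrite comp_lfunE tassoc_pure !tpair_pure mulrA.
Qed.

Lemma tpair_swap12 V (a b c : dual V) t :
  tpair a (tpair b c) (swap12 V t) = tpair b (tpair a c) t.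
Proof.
rewrite -[LHS]comp_lfunE; congr (fun_of_lfun _ t).
apply: tensor_ext3r => u v w.
by rewrite comp_lfunE swap12_pure !tpair_pure mulrCA.
Qed.

End Pairing.

(** * The quadrilinear identity of a dual pair *)

Definition jacobi (V : zmodType) (m : V -> V -> V) :=
  forall x y z, m x (m y z) + m y (m z x) + m z (m x y) = 0.

Definition nijenhuis (V : zmodType) (m : V -> V -> V) (n : V -> V) :=
  forall u v, m (n u) (n v) + n (n (m u v)) = n (m (n u) v) + n (m u (n v)).

Lemma eq_jacobi (V : zmodType) (m m' : V -> V -> V) :
  m =2 m' -> jacobi m -> jacobi m'.
Proof. by move=> eq_m J x y z; rewrite -!eq_m. Qed.

Lemma eq_nijenhuis (V : zmodType) (m m' : V -> V -> V) (n n' : V -> V) :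
  m =2 m' -> n =1 n' -> nijenhuis m n -> nijenhuis m' n'.
Proof. by move=> eq_m eq_n nij u v; rewrite -!eq_n -!eq_m nij. Qed.

Definition biadditive (U V W : zmodType) (m : U -> V -> W) :=
  (forall u v v', m u (v + v') = m u v + m u v')
  /\ (forall u u' v, m (u + u') v = m u v + m u' v).

Lemma addr3ACA (V : zmodType) (a a' b b' c c' : V) :
  a + b + c + (a' + b' + c') = a + a' + (b + b') + (c + c').
Proof. by rewrite [LHS]addrACA (addrACA a). Qed.

(** The abstract setting of the computations: [ad] and [Ad] are the coadjoint
    actions of the brackets [br] and [brd] with respect to a nondegenerate
    pairing [p]. Only additivity is assumed, and A and B play symmetric roles
    (see [dual_pair_sym]), so that each statement about [ad] also gives the one
    about [Ad]. *)
Record dual_pair (K : fieldType) (A B : zmodType) (p : B -> A -> K)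
    (br : A -> A -> A) (brd : B -> B -> B)
    (ad : A -> B -> B) (Ad : B -> A -> A) : Prop := DualPair {
  dp_biadd : biadditive p;
  dp_sepl : forall b b', p b =1 p b' -> b = b';
  dp_sepr : forall x x', p^~ x =1 p^~ x' -> x = x';
  dp_ad : forall x b y, p (ad x b) y = p b (br x y);
  dp_Ad : forall a x b, p b (Ad a x) = p (brd a b) x
}.

Lemma dual_pair_sym (K : fieldType) (A B : zmodType) (p : B -> A -> K) br brd
    ad Ad :
  dual_pair p br brd ad Ad -> dual_pair (fun x b => p b x) brd br Ad ad.
Proof. by case=> [[pr pl] ? ? adE AdE]; split. Qed.

(** This is the vanishing of the sum of <[t, u], [v, w]> over the three ways of
    pairing off four elements t, u, v, w of the double, in the case of two
    elements x, y of A and two elements a, b of B. *)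
Definition pairing_compat (K : fieldType) (A B : zmodType) (p : B -> A -> K)
    (br : A -> A -> A) (brd : B -> B -> B)
    (ad : A -> B -> B) (Ad : B -> A -> A) :=
  forall x y a b,
    p (brd a b) (br x y) = - (p (ad x a) (Ad b y) + p (ad x b) (Ad a y)
                              + p (ad y a) (Ad b x) + p (ad y b) (Ad a x)).

Lemma pairing_compat_sym (K : fieldType) (A B : zmodType) (p : B -> A -> K)
    br brd ad Ad :
  pairing_compat p br brd ad Ad -> pairing_compat (fun x b => p b x) brd br Ad ad.
Proof. by move=> c a b x y; rewrite (c x y a b); ring. Qed.

Section DualPair.
Variables (K : fieldType) (A B : zmodType) (p : B -> A -> K).
Variables (br : A -> A -> A) (brd : B -> B -> B).
Variables (ad : A -> B -> B) (Ad : B -> A -> A).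
Hypothesis dp : dual_pair p br brd ad Ad.
Hypotheses (brC : commutative br) (brdC : commutative brd).

Let pDr b x y : p b (x + y) = p b x + p b y. Proof. exact: (dp_biadd dp).1. Qed.
Let pDl a b x : p (a + b) x = p a x + p b x. Proof. exact: (dp_biadd dp).2. Qed.
Let p0r b : p b 0 = 0. Proof. by apply: (addrI (p b 0)); rewrite -pDr !addr0. Qed.
Let p0l x : p 0 x = 0. Proof. by apply: (addrI (p 0 x)); rewrite -pDl !addr0. Qed.
Let adE := dp_ad dp.
Let AdE := dp_Ad dp.

Lemma ad_rep : jacobi br ->
  forall x y b, ad (br x y) b = - ad x (ad y b) - ad y (ad x b).
Proof.
move=> brJ x y b; apply/eqP; rewrite -opprD -addr_eq0; apply/eqP.
apply: (dp_sepl dp) => z; rewrite p0l !pDl !adE -!pDr.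
by rewrite addrA (brC x z) (brC _ z) addrC addrA addrAC addrC addrA brJ p0r.
Qed.

(** Pairing the matched pair condition with y and moving every operator to the
    other side by adjunction gives [pairing_compat]. As the latter is symmetric
    in A and B, the two conditions of a matched pair are equivalent. *)
Lemma ad_compat :
  (forall x a b, ad x (brd a b) + brd (ad x a) b + brd a (ad x b)
     + ad (Ad b x) a + ad (Ad a x) b = 0) <-> pairing_compat p br brd ad Ad.
Proof.
have paired x a b y :
    p (ad x (brd a b) + brd (ad x a) b + brd a (ad x b)
       + ad (Ad b x) a + ad (Ad a x) b) y
    = p (brd a b) (br x y) + (p (ad x a) (Ad b y) + p (ad x b) (Ad a y)
                              + p (ad y a) (Ad b x) + p (ad y b) (Ad a x)).
  rewrite !pDl (adE x (brd a b)) !(adE (Ad _ _)) !(brC (Ad _ _)) -!(adE y).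
  by rewrite (brdC (ad x a)) -(AdE b) -(AdE a y (ad x b)); ring.
split=> [e x y a b | e x a b].
  by apply/eqP; rewrite -addr_eq0 -paired e p0l.
by apply: (dp_sepl dp) => y; rewrite paired e addNr p0l.
Qed.

(** The Jacobi identity of [br] paired with b: it removes from the sum over the
    three pairings the terms with three elements of A and one of B. *)
Lemma ad_jacobi : jacobi br -> forall x y z b,
  p (ad z b) (br x y) = - p (ad x b) (br y z) - p (ad y b) (br x z).
Proof.
move=> brJ x y z b; apply/eqP; rewrite -opprD -addr_eq0 !adE -!pDr.
by rewrite addrC (brC x z) brJ p0r.
Qed.

Lemma br0r x : br x 0 = 0.
Proof. by apply: (dp_sepr dp) => b; rewrite -adE !p0r. Qed.

Lemma ad0r x : ad x 0 = 0.
Proof. by apply: (dp_sepl dp) => y; rewrite adE !p0l. Qed.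

Lemma ad0l b : ad 0 b = 0.
Proof. by apply: (dp_sepl dp) => y; rewrite adE brC br0r p0r p0l. Qed.

End DualPair.

Section Double.
Variables (K : fieldType) (A B : zmodType) (p : B -> A -> K).
Variables (br : A -> A -> A) (brd : B -> B -> B).
Variables (ad : A -> B -> B) (Ad : B -> A -> A).
Hypothesis dp : dual_pair p br brd ad Ad.
Hypotheses (brC : commutative br) (brdC : commutative brd).

Let pDr b x y : p b (x + y) = p b x + p b y. Proof. exact: (dp_biadd dp).1. Qed.
Let pDl a b x : p (a + b) x = p a x + p b x. Proof. exact: (dp_biadd dp).2. Qed.
Let p0r b : p b 0 = 0. Proof. by apply: (addrI (p b 0)); rewrite -pDr !addr0. Qed.
Let p0l x : p 0 x = 0. Proof. by apply: (addrI (p 0 x)); rewrite -pDl !addr0. Qed.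
Let adE := dp_ad dp.
Let AdE := dp_Ad dp.
Let act0E :=
  let dp' := dual_pair_sym dp in
  (br0r dp, br0r dp', ad0r dp, ad0r dp', ad0l dp brC, ad0l dp' brdC).

Definition pair_form (u v : A * B) : K := p u.2 v.1 + p v.2 u.1.

(** The only bracket on the double that restricts to [br] and [brd] and leaves
    [pair_form] invariant (see [bicross_unique]). *)
Definition bicross (u v : A * B) : A * B :=
  (br u.1 v.1 + Ad u.2 v.1 + Ad v.2 u.1, brd u.2 v.2 + ad u.1 v.2 + ad v.1 u.2).

Lemma pair_formC u v : pair_form u v = pair_form v u. Proof. exact: addrC. Qed.

Lemma pair_formDr t u v : pair_form t (u + v) = pair_form t u + pair_form t v.
Proof. by rewrite /pair_form /= pDl pDr; ring. Qed.

Lemma pair_form0r t : pair_form t 0 = 0.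
Proof. by rewrite /pair_form /= p0l p0r addr0. Qed.

Lemma pair_form_sep u v : (forall w, pair_form w u = pair_form w v) -> u = v.
Proof.
case: u v => [x a] [y b] e; congr pair.
  by apply: (dp_sepr dp) => c; have := e (0, c); rewrite /pair_form /= !p0r !addr0.
by apply: (dp_sepl dp) => z; have := e (z, 0); rewrite /pair_form /= !p0l !add0r.
Qed.

Lemma bicrossC : commutative bicross.
Proof.
by move=> u v; rewrite /bicross brC brdC (addrAC (br _ _)) (addrAC (brd _ _)).
Qed.

Lemma bicross_sub :
  (forall x y, bicross (x, 0) (y, 0) = (br x y, 0))
  /\ (forall a b, bicross (0, a) (0, b) = (0, brd a b)).
Proof. by split=> *; rewrite /bicross /= !act0E !addr0. Qed.

Lemma pair_form_invariant u v w :
  pair_form (bicross u v) w = pair_form u (bicross v w).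
Proof.
case: u v w => [x a] [y b] [z c]; rewrite /pair_form /=.
rewrite !pDl !pDr !adE !AdE (brC y x) (brC z x) (brdC c a) (brdC b a).
ring.
Qed.

(** Invariance determines the mixed brackets: pairing [x, b] with y and with c
    leaves only brackets inside A and inside B. *)
Lemma bicross_unique D : biadditive D -> commutative D ->
    (forall u v w, pair_form (D u v) w = pair_form u (D v w)) ->
    (forall x y, D (x, 0) (y, 0) = (br x y, 0)) ->
    (forall a b, D (0, a) (0, b) = (0, brd a b)) ->
  D =2 bicross.
Proof.
move=> [DDr DDl] DC inv DA DB.
have mixed x b : D (x, 0) (0, b) = (Ad b x, ad x b).
  apply: pair_form_sep => -[y c].
  have -> : (y, c) = (y, 0) + (0, c) :> A * B.
    by rewrite -[RHS]/(_, _) addr0 add0r.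
  rewrite !(pair_formC (_ + _)) !pair_formDr !(pair_formC _ (_, 0)).
  rewrite -inv DA inv DB /pair_form /=.
  by rewrite !(p0l, p0r, addr0, add0r) adE AdE brC.
move=> [x a] [y b].
have split_pair z c : (z, c) = (z, 0) + (0, c) :> A * B.
  by rewrite -[RHS]/(_, _) addr0 add0r.
rewrite [in LHS](split_pair x) [in LHS](split_pair y) DDl !DDr DA DB.
rewrite mixed (DC (0, a)) mixed.
rewrite /bicross -[LHS]/(_, _) /=; congr pair; first by rewrite addr0 addrAC.
by rewrite add0r addrC (addrC (ad y a)) addrAC.
Qed.

(** By invariance, pairing [u, [v, w]] with t gives <[t, u], [v, w]>; as the form is
    nondegenerate, the Jacobi identity is equivalent to the vanishing of a
    quadrilinear form that is symmetric in its four arguments. *)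
Lemma invariant_jacobi D : commutative D ->
    (forall u v w, pair_form (D u v) w = pair_form u (D v w)) ->
  jacobi D <-> forall t u v w,
    pair_form (D t u) (D v w) + pair_form (D t v) (D w u)
    + pair_form (D t w) (D u v) = 0.
Proof.
move=> DC inv; split=> [DJ t u v w | Q0].
  by rewrite !inv -!pair_formDr DJ pair_form0r.
move=> u v w; apply: pair_form_sep => t.
by rewrite pair_form0r !pair_formDr -!(inv t) Q0.
Qed.

(** The symmetric quadrilinear form is evaluated according to how many of its
    arguments lie in A. With four or none it is zero, as A and B are isotropic
    subalgebras; with three or one it is the Jacobi identity of A or of B; with
    two it is [pairing_compat]. *)
Lemma bicross_jacobi : jacobi br -> jacobi brd ->
  jacobi bicross <-> pairing_compat p br brd ad Ad.
Proof.
move=> brJ brdJ; have jacA := ad_jacobi dp brC brJ.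
have jacB := ad_jacobi (dual_pair_sym dp) brdC brdJ.
rewrite (invariant_jacobi bicrossC pair_form_invariant).
split=> [Q0 x y a b | compat [x a] [y b] [z c] [t d]].
  have := Q0 (x, 0) (y, 0) (0, a) (0, b).
  rewrite /bicross /pair_form /= !(brC 0, brdC 0, act0E).
  rewrite !(addr0, add0r, p0l, p0r) -addrA => /eqP; rewrite addr_eq0 => /eqP ->.
  by ring.
rewrite /bicross /pair_form /= !pDl !pDr (brC t y) (brdC d b).
(* One instance of [compat] for each choice of the two arguments taken from A,
   one Jacobi identity for each choice of the single argument from A or B. *)
rewrite (compat x y c d) (compat x z b d) (compat x t b c).
rewrite (compat y z a d) (compat y t a c) (compat z t a b).
rewrite (jacA y z t a) (jacA x z t b) (jacA x y t c) (jacA x y z d).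
rewrite (jacB b c d x) (jacB a c d y) (jacB a b d z) (jacB a b c t).
ring.
Qed.

Definition nijenhuis_action (U V : zmodType) (n : U -> U) (act : U -> V -> V)
    (m : V -> V) :=
  forall x v, act (n x) (m v) + m (m (act x v))
            = m (act (n x) v) + m (act x (m v)).

(** By biadditivity the Nijenhuis identity needs checking on A x A, B x B and
    A x B only; the two components of the last case are the conditions on the
    two actions. *)
Lemma bicross_nijenhuis (N : A -> A) (M : B -> B) :
    {morph N : x y / x + y} -> {morph M : a b / a + b} ->
    nijenhuis br N -> nijenhuis brd M ->
  nijenhuis bicross (fun u => (N u.1, M u.2))
  <-> nijenhuis_action N ad M /\ nijenhuis_action M Ad N.
Proof.
move=> ND MD nijN nijM.
have N0 : N 0 = 0 by apply: (addrI (N 0)); rewrite -ND !addr0.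
have M0 : M 0 = 0 by apply: (addrI (M 0)); rewrite -MD !addr0.
split=> [nijD | [nij_ad nij_Ad] [x a] [y b]].
  have nij x b := nijD (x, 0) (0, b).
  split=> [x b | b x]; have [] := nij x b;
    rewrite /= N0 M0 !(brC 0, brdC 0, act0E) !(addr0, add0r).
    by [].
  by move=> -> _; rewrite addrC.
rewrite /bicross -[LHS]/(_, _) -[RHS]/(_, _) /= !(ND, MD).
rewrite !addr3ACA nijN nijM !nij_ad !nij_Ad.
by congr pair; congr (_ + _); rewrite addrC.
Qed.

End Double.

(** * The dual pair of a space and its dual *)

Lemma bilin_lfunE (K : fieldType) (U V W : vectType K) (f : U -> V -> W) u v :
  bilin f -> linfun (fun u => linfun (f u)) u v = f u v.
Proof.
move=> [linr linl]; rewrite linfunE ?linfunE // => k x y.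
by apply/lfunP => w; rewrite add_lfunE scale_lfunE !linfunE // linl.
Qed.

(** The two-argument function underlying an action or a bracket, which is the
    form in which the lemmas on dual pairs take it. *)
Definition act (K : fieldType) (U V : vectType K) (rho : 'Hom(U, 'End(V))) :
  U -> V -> V := fun u v => rho u v.

Lemma act_bilin (K : fieldType) (U V : vectType K) (rho : 'Hom(U, 'End(V))) :
  bilin (act rho).
Proof.
split=> [u | v] k x y; rewrite /act linearP //.
by rewrite add_lfunE scale_lfunE.
Qed.

Lemma bicross_bilin (K : fieldType) (A B : vectType K)
    (br : A -> A -> A) (brd : B -> B -> B) (ad : A -> B -> B) (Ad : B -> A -> A) :
  bilin br -> bilin brd -> bilin ad -> bilin Ad ->
  bilin (bicross br brd ad Ad : A * B -> A * B -> A * B).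
Proof.
move=> [br1 br2] [brd1 brd2] [ad1 ad2] [Ad1 Ad2].
split=> w k [x a] [y b]; rewrite /bicross /=; congr pair => /=;
  rewrite ?(br1, brd1, ad1, Ad1) ?(br2, brd2, ad2, Ad2) !scalerDr;
  exact/esym/addr3ACA.
Qed.

Definition natural_pairing {K : fieldType} {A : vectType K} (a : dual A) (x : A)
  : K := a x.

Section CoadjointPair.
Variables (K : fieldType) (A : vectType K).
Variables (br : 'Hom(A, 'End(A))) (brd : 'Hom(dual A, 'End(dual A))).

Lemma coad_dual_pair :
  dual_pair natural_pairing (act br) (act brd) (act (coad br)) (act (Coad brd)).
Proof.
split.
- by split=> [a x y | a b x]; rewrite /natural_pairing ?linearD ?add_lfunE.
- by move=> a b eq_ab; apply/lfunP.
- by move=> x y eq_xy; apply: dual_sep.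
- exact: coadE.
- by move=> a x b; apply: CoadE.
Qed.

End CoadjointPair.

Lemma coad_rep (K : fieldType) (A : vectType K) (br : 'Hom(A, 'End(A))) :
  is_mockLie br -> is_rep br (coad br).
Proof. by move=> [brC brJ]; apply: (ad_rep (coad_dual_pair br 0) brC brJ). Qed.

Lemma Coad_rep (K : fieldType) (A : vectType K)
    (brd : 'Hom(dual A, 'End(dual A))) :
  is_mockLie brd -> is_rep brd (Coad brd).
Proof.
move=> [brdC brdJ].
exact: (ad_rep (dual_pair_sym (coad_dual_pair 0 brd)) brdC brdJ).
Qed.

Section MatchedPairsManinTriples.
Variables (K : fieldType) (A : vectType K).
Variables (br : 'Hom(A, 'End(A))) (brd : 'Hom(dual A, 'End(dual A))).

Notation dp := (coad_dual_pair br brd).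
Notation compat :=
  (pairing_compat natural_pairing (act br) (act brd) (act (coad br))
     (act (Coad brd))).

Lemma matchedPair_pairing : is_mockLie br -> is_mockLie brd ->
  is_matchedPair br brd (coad br) (Coad brd) <-> compat.
Proof.
move=> hA hAd; have [[brC brJ] [brdC brdJ]] := (hA, hAd).
split=> [mp | c].
  by apply/(ad_compat dp brC brdC) => x a b; apply: (MP_compat mp).
split=> //.
- exact: (coad_rep hA).
- exact: (Coad_rep hAd).
- exact: (ad_compat dp brC brdC).2 c.
- exact: (ad_compat (dual_pair_sym dp) brdC brC).2 (pairing_compat_sym c).
Qed.

Definition double_bracket : 'Hom((A * dual A)%type, 'End((A * dual A)%type)) :=
  linfun (fun u : A * dual A => linfun (fun v : A * dual A =>
    bicross (act br) (act brd) (act (coad br)) (act (Coad brd)) u v)).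

Lemma double_bracketE u v :
  double_bracket u v
  = bicross (act br) (act brd) (act (coad br)) (act (Coad brd)) u v.
Proof. by apply: bilin_lfunE; apply: bicross_bilin; apply: act_bilin. Qed.

Lemma ManinTriple_pairing (N : 'End(A)) (M : 'End(dual A)) :
    is_NijenhuisMockLie br N -> is_NijenhuisMockLie brd M ->
  (exists brD, is_ManinTriple br N brd M brD) <->
  [/\ compat, is_NijenhuisRep br N (coad br) M
    & is_NijenhuisRep brd M (Coad brd) N].
Proof.
move=> hN hM; have [[[brC brJ] nijN] [[brdC brdJ] nijM]] := (hN, hM).
have nijE := bicross_nijenhuis dp brdC (linearD N) (linearD M) nijN nijM.
have jacE := bicross_jacobi dp brC brdC brJ brdJ.
have doubleE (u : A * dual A) : double_map N M u = (N u.1, M u.2).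
  by case: u => x a; rewrite double_mapE.
split=> [[brD mt] | [c repN repM]].
  have brDE : act brD
      =2 bicross (act br) (act brd) (act (coad br)) (act (Coad brd)).
    apply: (bicross_unique dp brC).
    - by split=> [u v v' | u u' v]; rewrite /act linearD ?add_lfunE.
    - exact: (mockLieC (MT_mockLie mt)).
    - exact: (MT_invariant mt).
    - exact: (MT_sub mt).
    - exact: (MT_sub_dual mt).
  have [|repN repM] := nijE.1 _.
    exact: eq_nijenhuis brDE doubleE (NML_Nijenhuis (MT_Nijenhuis mt)).
  split.
  - exact/jacE/(eq_jacobi brDE)/(mockLieJ (MT_mockLie mt)).
  - by split; [apply: coad_rep (NML_mockLie hN) | exact: repN].
  - by split; [apply: Coad_rep (NML_mockLie hM) | exact: repM].
have bicrossE : bicross (act br) (act brd) (act (coad br)) (act (Coad brd))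
    =2 act double_bracket by move=> u v; rewrite /act double_bracketE.
have mD : is_mockLie double_bracket.
  split; last exact: eq_jacobi bicrossE (jacE.2 c).
  by move=> u v; rewrite !double_bracketE; apply: bicrossC.
exists double_bracket; split=> //.
- by move=> x y; rewrite double_bracketE; apply: (bicross_sub dp brC brdC).1.
- by move=> a b; rewrite double_bracketE; apply: (bicross_sub dp brC brdC).2.
- move=> u v w; rewrite !double_bracketE.
  exact: (pair_form_invariant dp brC brdC).
split=> //; apply: (eq_nijenhuis bicrossE (fsym doubleE)).
by apply: nijE.2; split; [apply: NR_Nijenhuis repN | apply: NR_Nijenhuis repM].
Qed.

End MatchedPairsManinTriples.

(** * Bialgebras in terms of the pairing *)

Lemma tpairD (K : fieldType) (U V : vectType K) (a : dual U) (b : dual V) :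
  {morph tpair a b : s t / s + t}.
Proof. exact: linearD. Qed.

Lemma tpairN (K : fieldType) (U V : vectType K) (a : dual U) (b : dual V) :
  {morph tpair a b : t / - t}.
Proof. exact: linearN. Qed.

Section Bialgebra.
Variables (K : fieldType) (A : vectType K).
Variables (br : 'Hom(A, 'End(A))) (Delta : 'Hom(A, tensor A A)).
Notation brd := (dual_bracket Delta).

Lemma transpose_tpair (a b : dual A) : transpose Delta (tpair a b) = brd a b.
Proof. by apply/lfunP => x; rewrite transposeE dual_bracketE. Qed.

Lemma coad_transpose x : coad br x = transpose (br x).
Proof. by apply/lfunP => a; apply/lfunP => y; rewrite coadE transposeE. Qed.

(** The three terms of the co-Jacobi identity paired with a, b, c are
    [a, [b, c]], [[a, b], c] and [b, [a, c]], that is, up to commutativity, the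
    Jacobi identity of the dual bracket. *)
Lemma dual_mockLie_coalgebra : is_mockLie brd -> is_mockLieCoalgebra Delta.
Proof.
move=> [brdC brdJ]; split=> x.
  by apply: tpair_sep => a b; rewrite tpair_tflip -!dual_bracketE brdC.
apply: tpair_sep3 => a b c; rewrite linear0.
have /lfunP/(_ x) := brdJ a b c.
rewrite !tpairD tpair_swap12 tpair_tassoc !tpair_tmap !transpose1.
rewrite !transpose_tpair -!dual_bracketE (brdC c a) (brdC c) !add_lfunE.
by rewrite zero_lfunE addrAC.
Qed.

Lemma dual_nijenhuis_coalgebra (S : 'End(A)) :
  is_NijenhuisMockLie brd (transpose S) -> is_NijenhuisCoalgebra Delta S.
Proof.
move=> [hAd nij]; split=> [|x]; first exact: dual_mockLie_coalgebra.
apply: tpair_sep => a b; have /lfunP/(_ x) := nij a b.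
rewrite !add_lfunE !transposeE !dual_bracketE.
by rewrite !tpairD !tpair_tmap !transpose1.
Qed.

(** Paired with a and b, the operators [x, -] and [y, -] on the right-hand side
    become coadjoint actions on a and b; adjunction then moves the dual bracket
    to [Coad]. *)
Lemma bialgebra_pairing : is_mockLie brd ->
  (forall x y, Delta (br x y) =
      - tmap (br x) \1%VF (Delta y) - tmap \1%VF (br x) (Delta y)
      - tmap (br y) \1%VF (Delta x) - tmap \1%VF (br y) (Delta x))
  <-> pairing_compat natural_pairing (act br) (act brd)
        (act (coad br)) (act (Coad brd)).
Proof.
move=> [brdC _].
have paired x y a b : tpair a b (- tmap (br x) \1%VF (Delta y)
      - tmap \1%VF (br x) (Delta y)
      - tmap (br y) \1%VF (Delta x) - tmap \1%VF (br y) (Delta x))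
   = - (brd b (coad br x a) y + brd a (coad br x b) y
        + brd b (coad br y a) x + brd a (coad br y b) x).
  rewrite !tpairD !tpairN !tpair_tmap !transpose1 -!coad_transpose.
  by rewrite -!dual_bracketE !(brdC _ b) !opprD.
have pE (a b : dual A) x : natural_pairing b (act (Coad brd) a x) = brd a b x.
  exact: CoadE.
split=> [e x y a b | c x y].
  by rewrite !pE -paired -e -dual_bracketE.
apply: tpair_sep => a b; rewrite paired -dual_bracketE.
by have := c x y a b; rewrite !pE.
Qed.

(** Transposition: the Nijenhuis condition on the coadjoint action, evaluated at
    a and y, is the condition on S with a applied to both sides. *)
Lemma nijenhuisRep_coad (N S : 'End(A)) : is_mockLie br ->
  is_NijenhuisRep br N (coad br) (transpose S) <->
  forall x y, S (br (N x) y) + br x (S (S y)) = br (N x) (S y) + S (br x (S y)).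
Proof.
move=> hA; split=> [[_ nij] x y | e].
  apply: dual_sep => a; have /lfunP/(_ y) := nij x a.
  by rewrite !add_lfunE !transposeE !coadE !transposeE !linearD.
split=> [|x a]; first exact: coad_rep.
apply/lfunP => y.
rewrite !add_lfunE !transposeE !coadE !transposeE.
by have /(congr1 a) := e x y; rewrite !linearD.
Qed.

(** Both identities become the same scalar identity when the first is evaluated
    by b and the second is paired with a and b. *)
Lemma nijenhuisRep_Coad (N S : 'End(A)) : is_mockLie brd ->
  is_NijenhuisRep brd (transpose S) (Coad brd) N <->
  forall x,
    tmap S \1%VF (Delta (N x)) + tmap \1%VF (N \o N)%VF (Delta x)
    = tmap S N (Delta x) + tmap \1%VF N (Delta (N x)).
Proof.
move=> hAd.
have transposeNN b : transpose (N \o N)%VF b = transpose N (transpose N b).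
  by apply/lfunP => x; rewrite !transposeE comp_lfunE.
split=> [[_ nij] x | e].
  apply: tpair_sep => a b; have /(congr1 b) := nij a x.
  rewrite !tpairD !tpair_tmap !transpose1 transposeNN !linearD /=.
  by rewrite -!(transposeE N) !CoadE -!dual_bracketE.
split=> [|a x]; first exact: Coad_rep.
apply: dual_sep => b; have /(congr1 (tpair a b)) := e x.
rewrite !tpairD !tpair_tmap !transpose1 transposeNN !linearD /=.
by rewrite -!(transposeE N) !CoadE -!dual_bracketE.
Qed.

End Bialgebra.

(** * The equivalence *)

Theorem theorem4p14 (K : fieldType) (charK0 : [pchar K] =i pred0)
    (A : vectType K) (br : 'Hom(A, 'End(A))) (N : 'End(A))
    (hA : is_NijenhuisMockLie br N)
    (Delta : 'Hom(A, tensor A A)) (S : 'End(A))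
    (hAd : is_NijenhuisMockLie (dual_bracket Delta) (transpose S)) :
  [<-> is_NijenhuisMatchedPair br N (dual_bracket Delta) (transpose S)
         (coad br) (Coad (dual_bracket Delta));
       exists brD : 'Hom((A * dual A)%type, 'End((A * dual A)%type)),
         is_ManinTriple br N (dual_bracket Delta) (transpose S) brD;
       is_NijenhuisBialgebra br Delta N S].
Proof.
have [mA mAd] := (NML_mockLie hA, NML_mockLie hAd).
have matchedE := matchedPair_pairing mA mAd.
have maninE := ManinTriple_pairing hA hAd.
have bialgE := bialgebra_pairing br mAd.
have coadE := nijenhuisRep_coad N S mA.
have CoadE := nijenhuisRep_Coad N S mAd.
split.
  move=> mp; apply/maninE; split; last exact: NMP_rep' mp.
    exact/matchedE/(NMP_matchedPair mp).
  exact: NMP_rep mp.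
split=> [/maninE[compat rep rep'] | bi].
  have coalg := dual_nijenhuis_coalgebra hAd.
  split=> //; [split=> // | exact/coadE | exact/CoadE].
    exact: NC_coalgebra coalg.
  exact/bialgE.
split=> //; [apply/matchedE/bialgE | apply/coadE | apply/CoadE].
- exact: bialg_compat (NB_bialgebra bi).
- exact: NB_compat bi.
- exact: NB_cocompat bi.
Qed.
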